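(* Let $\Delta=\bigsqcup_{i\in\mathbb Z}\Delta(i)$ be a $\mathbb Z$-grading of an irreducible reduced crystallographic root system with compatible positive system $\Delta^+=\Delta(0)^+\sqcup\Delta(1)\sqcup\Delta(2)\sqcup\cdots$. If $I$ is a lower ideal of $(\Delta(1),\preccurlyeq)$, then $\langle I\rangle=\bigcup_{k\ge1}I^k$ is a bi-convex subset of $\Delta^+$, i.e., both $\langle I\rangle$ and $\Delta^+\setminus\langle I\rangle$ are closed under addition (within $\Delta$).
   Context: A $\mathbb Z$-grading of $\Delta$ is a disjoint decomposition $\Delta=\bigsqcup_{i\in\mathbb Z}\Delta(i)$ such that whenever $\gamma_1\in\Delta(i_1)$, $\gamma_2\in\Delta(i_2)$ and $\gamma_1+\gamma_2\in\Delta$, then $\gamma_1+\gamma_2\in\Delta(i_1+i_2)$; compatibility means $\Delta^+=\Delta(0)^+\sqcup\bigsqcup_{i\ge1}\Delta(i)$ with $\Delta(0)^+$ a positive system of the root system $\Delta(0)$. The order: $\mu\preccurlyeq\gamma$ iff $\gamma-\mu$ is a nonnegative integer combination of simple roots; $\Delta(1)$ carries the restricted order; a lower ideal is a downward closed subset. For $I\subset\Delta^+$: $I^1=I$, $I^k=(I+I^{k-1})\cap\Delta$ for $k\ge2$, $\langle I\rangle=\bigcup_{k\ge1}I^k$. A subset $M\subset\Delta^+$ is closed if $\gamma_1,\gamma_2\in M$, $\gamma_1+\gamma_2\in\Delta$ imply $\gamma_1+\gamma_2\in M$. *)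

(* Defs.v *)
From HB Require Import structures.
From mathcomp Require Import all_boot all_order all_algebra.
From mathcomp Require Import boolp classical_sets cardinality.

Set Implicit Arguments.
Unset Strict Implicit.
Unset Printing Implicit Defensive.

Import Order.TTheory GRing.Theory Num.Theory.
Local Open Scope classical_set_scope.
Local Open Scope ring_scope.

(* A Euclidean space is a finite-dimensional E with a positive definite
   symmetric form, {dot E for idfun}; R may be any ordered field, the real
   numbers being one instance. *)

Section RootSystem.
Variables (R : realFieldType) (E : vectType R) (form : {dot E for idfun}).

Definition spanning (D : set E) : Prop :=
  exists s : seq E, (forall v, v \in s -> D v) /\ <<s>>%VS = fullv.

Definition cartan (b a : E) : R := 2 * form b a / form a a.

Definition reflection (a v : E) : E := v - cartan v a *: a.

Record crystallographic_root_system (D : set E) : Prop := {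
  root_finite : finite_set D;
  root_neq0 : ~ D 0;
  root_spanning : spanning D;
  root_reflection : forall a b, D a -> D b -> D (reflection a b);
  root_integral : forall a b, D a -> D b -> exists z : int, cartan b a = z%:~R
}.

Definition reduced (D : set E) : Prop :=
  forall (a : E) (c : R), D a -> D (c *: a) -> c = 1 \/ c = -1.

(* Orthogonal A and B are automatically disjoint, since a root system does not
   contain 0. *)
Definition irreducible (D : set E) : Prop :=
  D !=set0 /\
  ~ exists A B : set E,
      [/\ A !=set0, B !=set0, D = A `|` B &
          forall a b, A a -> B b -> form a b = 0].

End RootSystem.

Section PositiveSystems.
Variables (R : realFieldType) (E : vectType R).

Definition nonneg_int_comb (Pi : seq E) (v : E) : Prop :=
  exists c : E -> nat, v = \sum_(b <- Pi) b *+ c b.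

(* D need not span E, so that the definition also applies to the root
   system Delta(0) in its own span. *)
Definition is_base (D : set E) (Pi : seq E) : Prop :=
  [/\ free Pi, (forall b, b \in Pi -> D b) &
      forall v, D v -> nonneg_int_comb Pi v \/ nonneg_int_comb Pi (- v)].

Definition positive_roots (D : set E) (Pi : seq E) : set E :=
  [set v | D v /\ nonneg_int_comb Pi v].

Definition positive_system (D P : set E) : Prop :=
  exists Pi : seq E, is_base D Pi /\ P = positive_roots D Pi.

Definition root_le (Pi : seq E) (mu gamma : E) : Prop :=
  nonneg_int_comb Pi (gamma - mu).

Definition lower_ideal (Pi : seq E) (X I : set E) : Prop :=
  I `<=` X /\
  forall mu gamma, I gamma -> X mu -> root_le Pi mu gamma -> I mu.

Record is_grading (D : set E) (Dg : int -> set E) : Prop := {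
  grading_cover : D = \bigcup_i Dg i;
  grading_disjoint : forall i j, i <> j -> Dg i `&` Dg j = set0;
  grading_add : forall i j a b,
    Dg i a -> Dg j b -> D (a + b) -> Dg (i + j) (a + b)
}.

(* The union is automatically disjoint when Dg is a grading, since D0plus is
   contained in Dg 0. *)
Definition compatible (Dg : int -> set E) (Dplus : set E) : Prop :=
  exists D0plus : set E,
    positive_system (Dg 0) D0plus /\
    Dplus = D0plus `|` \bigcup_(i in [set i : int | 1 <= i]) Dg i.

Definition sumset (A B : set E) : set E := [set a + b | a in A & b in B].

(* The value at exponent 0 is a dummy, only k >= 1 is used. *)
Fixpoint ideal_pow (D I : set E) (k : nat) : set E :=
  match k with
  | 0%N => set0
  | k'.+1 => if k' is 0%N then I else sumset I (ideal_pow D I k') `&` D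
  end.

Definition generated (D I : set E) : set E :=
  \bigcup_(k in [set k : nat | (1 <= k)%N]) ideal_pow D I k.

Definition add_closed (D M : set E) : Prop :=
  forall a b, M a -> M b -> D (a + b) -> M (a + b).

Definition biconvex (D Dplus M : set E) : Prop :=
  [/\ M `<=` Dplus, add_closed D M & add_closed D (Dplus `\` M)].

End PositiveSystems.

(* Main.v *)
Require Import Defs.
From HB Require Import structures.
From mathcomp Require Import all_boot all_order all_algebra.
From mathcomp Require Import boolp classical_sets cardinality.
From mathcomp Require Import zify lra.

Set Implicit Arguments.
Unset Strict Implicit.
Unset Printing Implicit Defensive.

Import Order.TTheory GRing.Theory Num.Theory.
Local Open Scope classical_set_scope.
Local Open Scope ring_scope.

(* The engine is a three-root lemma: if a, b, g and a + b + g are roots and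
   a + b <> 0, then a + g or b + g is a root or zero.  It gives closedness of
   <I> by induction on the number of summands from I.  For the complement, let
   a + b = i + c with a, b positive, i in I and c in <I>.  The lemma applied to
   a, b, - i makes, up to symmetry, e := a - i a root (or zero), so that
   c = b + e and a = i + e.  If e > 0, induct on c.  If f := - e > 0, then
   i = a + f has degree 1, so a or f has degree 1 and lies below i, hence in I;
   in the latter case b = c + f is in <I>. *)

Section RootSystem.
Variables (R : realFieldType) (E : vectType R) (form : {dot E for idfun}).
Variables (D : set E).
Hypothesis hD : crystallographic_root_system form D.

Lemma form_sym (u v : E) : form u v = form v u.
Proof. by rewrite hermC expr0 mul1r. Qed.

(* The next three are [linearDl], [linearDr] and [linearNr] with [form] kept in
   its original structure, which rewriting with those lemmas does not do. *)
Lemma formDl (u v w : E) : form (u + v) w = form u w + form v w.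
Proof. exact: linearDl. Qed.

Lemma formDr (u v w : E) : form u (v + w) = form u v + form u w.
Proof. exact: linearDr. Qed.

Lemma formNr (u v : E) : form u (- v) = - form u v.
Proof. exact: linearNr. Qed.

Lemma form_gt0 (u : E) : u != 0 -> 0 < form u u.
Proof. exact: neq0_dnorm_gt0. Qed.

Lemma root_neq (a : E) : D a -> a != 0.
Proof. by move=> Da; apply/eqP => a0; apply: (root_neq0 hD); rewrite -a0. Qed.

Lemma root_opp (a : E) : D a -> D (- a).
Proof.
move=> Da; have := root_reflection hD Da Da.
rewrite /reflection /cartan mulfK ?gt_eqF ?form_gt0 ?root_neq//.
by rewrite scaler_nat mulr2n opprD addrA subrr add0r.
Qed.

(* A negative Cartan integer is -1, in which case the reflection of one root in
   the other is the sum, or at most -2; if both are at most -2 then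
   |a + b|^2 <= 0. *)
Lemma root_sum_of_obtuse (a b : E) :
  D a -> D b -> form a b < 0 -> D (a + b) \/ a + b = 0.
Proof.
have cartan_le (x y : E) : D x -> D y -> form x y < 0 ->
    D (x + y) \/ form x x <= - form x y.
  move=> Dx Dy xy0; have xx0 := form_gt0 (root_neq Dx).
  have [z ez] := root_integral hD Dx Dy.
  have ezM : 2 * form x y = z%:~R * form x x.
    by rewrite -ez /cartan (form_sym y x) divfK ?gt_eqF.
  have [ez1|nz1] := eqVneq z (-1).
    left; have := root_reflection hD Dx Dy.
    by rewrite /reflection ez ez1 rmorphN1 scaleN1r opprK addrC.
  right; have z_lt0 : z < 0.
    by rewrite -(ltrz0 R) -(pmulr_llt0 (z%:~R) xx0) -ezM pmulr_rlt0.
  have z_le : z <= -2 by lia.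
  have : z%:~R * form x x <= (-2)%:~R * form x x by rewrite ler_pM2r// ler_int.
  rewrite -ezM; lra.
move=> Da Db ab0.
have [|aa_le] := cartan_le _ _ Da Db ab0; first by left.
have ba0 : form b a < 0 by rewrite form_sym.
have [|bb_le] := cartan_le _ _ Db Da ba0; first by rewrite addrC; left.
right; apply/eqP; apply: contraT => /form_gt0.
rewrite (form_sym b a) in bb_le.
rewrite formDl !formDr (form_sym b a); lra.
Qed.

(** Put [d = a + b + g]. If one of the pairs [(a, g)], [(b, g)], [(d, - a)], [(d, - b)] is obtuse,
    its sum is [a + g] or [b + g], hence a root or zero. Otherwise [form d (a + b) <= 0] and
    [form g (a + b) >= 0], so [form (a + b) (a + b) <= 0], against [a + b != 0]. *)
Lemma three_root_sum (a b g : E) :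
  D a -> D b -> D g -> D (a + b + g) -> a + b != 0 ->
  (D (a + g) \/ a + g = 0) \/ (D (b + g) \/ b + g = 0).
Proof.
move=> Da Db Dg Dabg ab0; set d := a + b + g in Dabg.
have obtuse := root_sum_of_obtuse.
have [ag|ag] := ltP (form a g) 0; first by left; exact: obtuse.
have [bg|bg] := ltP (form b g) 0; first by right; exact: obtuse.
have [da|da] := ltP 0 (form d a).
  right; have -> : b + g = d + - a by rewrite /d -(addrA a) [RHS]addrC addKr.
  by apply: obtuse => //; [exact: root_opp | rewrite formNr oppr_lt0].
have [db|db] := ltP 0 (form d b).
  left; have -> : a + g = d + - b by rewrite /d [RHS]addrAC addrK.
  by apply: obtuse => //; [exact: root_opp | rewrite formNr oppr_lt0].
exfalso; have := form_gt0 ab0; move: da db; rewrite /d !formDl !formDr.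
rewrite (form_sym g a) (form_sym g b); lra.
Qed.

End RootSystem.

Section Generated.
Variables (R : realFieldType) (E : vectType R) (D I : set E).

Lemma generated_base (x : E) : I x -> generated D I x.
Proof. by exists 1%N. Qed.

Lemma generated_step (i c : E) :
  I i -> generated D I c -> D (i + c) -> generated D I (i + c).
Proof.
move=> Ii [[|k]//= _ Ic] Dic; exists k.+2 => //=; split => //.
by exists i => //; exists c.
Qed.

(** Hides the exponent [k]: later inductions peel off one leftmost summand from [I] at a time. *)
Lemma generated_ind (P : E -> Prop) :
  (forall x, I x -> P x) ->
  (forall i c, I i -> generated D I c -> P c -> D (i + c) -> P (i + c)) ->
  forall x, generated D I x -> P x.
Proof.
move=> P1 PS x [[|k]//= _]; elim: k x => [|k IHk] x; first exact: P1.
case=> -[i Ii [c Ic <-]] Dic; apply: PS => //; last exact: IHk.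
by exists k.+1.
Qed.

Lemma generated_sub : I `<=` D -> generated D I `<=` D.
Proof. by move=> ID x; apply: generated_ind. Qed.

Lemma generated_add_closed (form : {dot E for idfun}) :
  crystallographic_root_system form D -> I `<=` D ->
  add_closed D (generated D I).
Proof.
move=> hD ID a b Ia Ib.
(* The induction keeps [b] general: if [i + b] is a root, the sum is regrouped as [c + (i + b)] and
   the hypothesis on [c] is used with [i + b] in place of [b]. *)
elim/generated_ind: Ia b Ib => [i Ii|i c Ii Ic IHc Dic] b Ib.
  exact: generated_step.
rewrite -addrA => Dicb.
have gD := generated_sub ID.
have : (D (i + b) \/ i + b = 0) \/ (D (c + b) \/ c + b = 0).
  apply: (three_root_sum hD (ID _ Ii) (gD _ Ic) (gD _ Ib)).
    by rewrite -addrA.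
  exact: (root_neq hD).
case=> -[].
- move=> Dib; rewrite addrCA in Dicb *.
  by apply: IHc => //; exact: generated_step.
- by move=> ib0; rewrite addrCA ib0 addr0.
- by move=> Dcb; apply: generated_step => //; exact: IHc.
- by move=> cb0; rewrite cb0 addr0; exact: generated_base.
Qed.

End Generated.

Section Grading.
Variables (R : realFieldType) (E : vectType R).
Variables (D : set E) (Pi : seq E) (Dg : int -> set E).
Hypothesis hgrad : is_grading D Dg.
Hypothesis hcompat : compatible Dg (positive_roots D Pi).
Let P := positive_roots D Pi.

Lemma positive_rootD (a b : E) : P a -> P b -> D (a + b) -> P (a + b).
Proof.
move=> [_ [c ->]] [_ [d ->]] Dab; split => //.
exists (fun x => c x + d x)%N; rewrite -big_split.
by apply: eq_bigr => x _; rewrite mulrnDr.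
Qed.

Lemma degree_inj (i j : int) (x : E) : Dg i x -> Dg j x -> i = j.
Proof.
move=> ix jx; apply: contrapT => /(grading_disjoint hgrad) ij0.
by have : (Dg i `&` Dg j) x by []; rewrite ij0.
Qed.

Lemma positive_root_degree (x : E) : P x -> exists n : nat, Dg n x.
Proof.
have [D0 [[Pi0 [_ D0E]] PE]] := hcompat.
rewrite /P PE => -[|[[n|n] //= _ nx]]; last by exists n.
by rewrite D0E => -[x0 _]; exists 0%N.
Qed.

Lemma degree_ge1_positive (i : int) (x : E) : 1 <= i -> Dg i x -> P x.
Proof.
by have [D0 [_ PE]] := hcompat => i1 ix; rewrite /P PE; right; exists i.
Qed.

Variable I : set E.
Hypothesis hI : lower_ideal Pi (Dg 1) I.

Lemma lower_ideal_positive : I `<=` P.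
Proof. by move=> x /(hI.1 x); exact: degree_ge1_positive. Qed.

(** The degrees of [a] and [b] are natural numbers with sum 1, so one of the two roots lies in
    [Dg 1]. It is below [a + b] because the difference is the other, positive, root. *)
Lemma lower_ideal_split (a b : E) : P a -> P b -> I (a + b) -> I a \/ I b.
Proof.
move=> Pa Pb Iab; have Dab1 := hI.1 _ Iab.
have [Dab _] := lower_ideal_positive Iab.
have [[m am] [n bn]] := (positive_root_degree Pa, positive_root_degree Pb).
have := degree_inj (grading_add hgrad am bn Dab) Dab1.
case: m am => [|m] am mn.
  right; apply: (hI.2 b _ Iab); last by rewrite /root_le addrK; exact: Pa.2.
  by rewrite add0r in mn; rewrite -mn.
left; apply: (hI.2 a _ Iab); last by rewrite /root_le addrC addKr; exact: Pb.2.
have m0 : m = 0%N by lia.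
by rewrite m0 in am; exact: am.
Qed.

Variable form : {dot E for idfun}.
Hypothesis hD : crystallographic_root_system form D.
Hypothesis hPi : is_base D Pi.

(** The contrapositive form of closedness of the complement. *)
Lemma generated_split (a b : E) :
  P a -> P b -> generated D I (a + b) -> generated D I a \/ generated D I b.
Proof.
have ID : I `<=` D by move=> x /lower_ideal_positive [].
have gD := generated_sub ID.
move=> Pa Pb; move sE : (a + b) => s Is; elim/generated_ind: Is a b Pa Pb sE.
  move=> i Ii a b Pa Pb iE; rewrite -iE in Ii.
  by have [] := lower_ideal_split Pa Pb Ii; [left|right]; exact: generated_base.
move=> i c Ii Ic IHc Dic a b Pa Pb sE.
(* Stated for fresh [a'], [b'] so that it serves both outcomes of the three-root lemma, with [a] and
   [b] exchanged in the second. *)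
have summand a' b' : P a' -> P b' -> a' + b' = i + c ->
    D (a' - i) \/ a' - i = 0 -> generated D I a' \/ generated D I b'.
  move=> {}Pa {}Pb {}sE ai.
  case: ai => [De|/eqP]; last first.
    by rewrite subr_eq0 => /eqP ->; left; exact: generated_base.
  set e := a' - i in De; have aE : a' = i + e by rewrite /e addrC subrK.
  have cE : e + b' = c by apply: (addrI i); rewrite addrA -aE.
  have [_ _ base_sign] := hPi.
  (* For positive [e], the induction hypothesis splits [c = e + b']; if [e] is generated, so is
     [a' = i + e]. *)
  have [e_pos|f_pos] := base_sign _ De.
    have [Ie|] := IHc e b' (conj De e_pos) Pb cE; last by right.
    by left; rewrite aE; apply: generated_step => //; rewrite -aE; exact: Pa.1.
  have Pf : P (- e) by split => //; exact: root_opp hD _ De.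
  have iE : a' + - e = i by rewrite aE addrK.
  have [Ia|If] : I a' \/ I (- e) by apply: lower_ideal_split => //; rewrite iE.
    by left; exact: generated_base.
  right; have bE : b' = - e + c by rewrite -cE addKr.
  by rewrite bE; apply: generated_step => //; rewrite -bE; exact: Pb.1.
(* The three-root lemma applies with third root [- i]: [a + b - i] is the root [c], and
   [a + b = i + c] is a root, hence nonzero. *)
have : (D (a - i) \/ a - i = 0) \/ (D (b - i) \/ b - i = 0).
  apply: (three_root_sum hD Pa.1 Pb.1 (root_opp hD (ID _ Ii))).
    by rewrite sE addrC addKr; exact: gD.
  by rewrite sE; exact: (root_neq hD).
case; first exact: summand.
by move/(summand _ _ Pb Pa) => /(_ (etrans (addrC _ _) sE)) [|]; [right|left].
Qed.

End Grading.

Theorem theorem3p3 (R : realFieldType) (E : vectType R)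
    (form : {dot E for idfun})
    (Delta : set E) (Pi : seq E) (Dplus : set E) (Dg : int -> set E)
    (I : set E)
    (hDelta : crystallographic_root_system form Delta)
    (hred : reduced Delta)
    (hirr : irreducible form Delta)
    (hPi : is_base Delta Pi)
    (hDplus : Dplus = positive_roots Delta Pi)
    (hgrad : is_grading Delta Dg)
    (hcompat : compatible Dg Dplus)
    (hI : lower_ideal Pi (Dg 1) I) :
  biconvex Delta Dplus (generated Delta I).
Proof.
subst Dplus; have IP := lower_ideal_positive hcompat hI.
have ID : I `<=` Delta by move=> x /IP [].
split.
- move=> x; elim/generated_ind => // i c Ii _ Pc Dic.
  exact: positive_rootD (IP _ Ii) Pc Dic.
- exact: generated_add_closed hDelta ID.
- move=> a b [Pa nIa] [Pb nIb] Dab; split; first exact: positive_rootD.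
  by move/(generated_split hgrad hcompat hI hDelta hPi Pa Pb) => [].
Qed.
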